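(* Consider the following cooperative multi-player multi-armed bandit problem (''Problem A''). There are $M$ players $P_1,\dots,P_M$; player $P_i$ has a finite set $\mathcal{K}_i=\{1,\dots,K_i\}$ of arms. At each round $t=1,\dots,T$ each player $P_i$ picks an arm $a_i(t)\in\mathcal{K}_i$, giving the arm-tuple $a(t)=(a_1(t),\dots,a_M(t))$. For each arm-tuple $a\in\mathcal{K}_1\times\cdots\times\mathcal{K}_M$ there is an unknown $1$-subgaussian distribution $F_a$ supported in $[0,1]$ with mean $\mu_a$; when $a(t)$ is played, a reward $X_{a(t)}(t)\sim F_{a(t)}$ is drawn independently across rounds and this common reward is observed by all players. No player observes the arms chosen by the others and there is no communication during play. Let $\mu^*=\max_a\mu_a$, $\Delta_a=\mu^*-\mu_a$, and $R_T=\mathbb{E}\big[T\mu^*-\sum_{t=1}^T X_{a(t)}(t)\big]$. Suppose every player runs the \texttt{mUCB} algorithm: in the first $K_1\cdots K_M$ rounds, player $P_i$ starts at its arm $1$ and successively pulls each of its arms $K_{i+1}\cdots K_M$ consecutive times before moving to the next arm, repeating this epoch $K_1\cdots K_{i-1}$ times (so every tuple is played once); afterwards, at round $t$, each player computes for each tuple $a$ the index $\eta_a(t)=\infty$ if $n_a(t)=0$ and otherwise $\eta_a(t)=\hat\mu_a(t)+\sqrt{2\log(1/\delta)/n_a(t)}$ with $\delta=1/t^2$, where $n_a(t)$ is the number of times tuple $a$ was played in the first $t$ rounds and $\hat\mu_a(t)$ the average of the corresponding rewards, and player $P_i$ plays the $i$-th component of a maximizing tuple, ties broken in favour of the lexicographically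 smallest tuple. Let $\epsilon=\sqrt{\log T/T}$. Then $$R_T\le 3K_1\cdots K_M+\Big(1+\sum_{a:\,\Delta_a>\epsilon}(6+4\sqrt2)\Big)\sqrt{T\log T}.$$
   Context: Lexicographic order: $(x_1,\dots,x_M)<(y_1,\dots,y_M)$ iff there is $n$ with $x_j=y_j$ for all $j<n$ and $x_n<y_n$. *)

(* Defs.v *)
From HB Require Import structures.
From mathcomp Require Import all_boot all_order all_algebra.
From mathcomp Require Import all_classical all_reals all_analysis.
Set Implicit Arguments. Unset Strict Implicit. Unset Printing Implicit Defensive.
Import Order.TTheory GRing.Theory Num.Theory.
Import numFieldNormedType.Exports.
Local Open Scope classical_set_scope.
Local Open Scope ring_scope.

(* Model of "Problem A" (cooperative multi-player bandit) and of mUCB.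
   Players are indexed by i : 'I_M (player P_{i+1} in the paper);
   the arms of player i are 'I_(K i) (arm j of the paper is ordinal j-1).
   Rounds are numbered t = 1, 2, ... *)

Section MUCB.
Variables (M : nat) (K : 'I_M -> nat).

Definition Arms := {dffun forall i : 'I_M, 'I_(K i)}.

Definition lex_lt (a b : Arms) : bool :=
  [exists n : 'I_M, [forall j : 'I_M, (j < n)%N ==> (a j == b j)]
                    && (a n < b n)%N].
Definition lex_le (a b : Arms) : bool := (a == b) || lex_lt a b.

Definition Nprod : nat := \prod_(i < M) K i.
Definition suffix_prod (i : 'I_M) : nat := \prod_(j < M | (i < j)%N) K j.

Variable Kpos : forall i, (0 < K i)%N.

(* initial phase: at round t (1 <= t <= K_1...K_M) player i plays the arm
   ((t-1) / (K_{i+1}...K_M)) mod K_i, i.e. it pulls each of its arms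
   K_{i+1}...K_M consecutive times starting from its first arm, and repeats
   this epoch K_1...K_{i-1} times. *)
Definition init_arm (t : nat) (i : 'I_M) : 'I_(K i) :=
  Ordinal (ltn_pmod (t.-1 %/ suffix_prod i) (Kpos i)).
Definition init_tuple (t : nat) : Arms := finfun (fun i => init_arm t i).

Variable R : realType.

(* h : plays of rounds 1..size h ; r a s : reward of tuple a at round s *)
Definition n_played (h : seq Arms) (a : Arms) : nat := count (pred1 a) h.
Definition reward_sum (r : Arms -> nat -> R) (h : seq Arms) (a : Arms) : R :=
  \sum_(s < size h | nth a h s == a) r a s.+1.

Definition ucb_index (r : Arms -> nat -> R) (h : seq Arms) (t : nat)
    (a : Arms) : \bar R :=
  let n := n_played h a in
  let delta : R := (t%:R ^+ 2)^-1 in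
  if n == 0%N then +oo%E
  else (reward_sum r h a / n%:R + Num.sqrt (2 * ln (delta^-1) / n%:R))%:E.

(* maximizer of the index, ties broken in favour of the lexicographically
   smallest tuple (the default value is never used: a maximizer exists) *)
Definition ucb_choice (r : Arms -> nat -> R) (h : seq Arms) (t : nat) : Arms :=
  odflt (init_tuple 1)
    [pick a | [forall b, (ucb_index r h t b <= ucb_index r h t a)%E]
              && [forall b, (ucb_index r h t b == ucb_index r h t a)
                              ==> lex_le a b]].

Definition next_play (r : Arms -> nat -> R) (h : seq Arms) : Arms :=
  let t := (size h).+1 in
  if (t <= Nprod)%N then init_tuple t else ucb_choice r h t.

Fixpoint history (r : Arms -> nat -> R) (n : nat) : seq Arms :=
  if n is n'.+1 then rcons (history r n') (next_play r (history r n'))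
  else [::].

Definition play (r : Arms -> nat -> R) (t : nat) : Arms :=
  nth (init_tuple 1) (history r t) t.-1.

Definition total_reward (r : Arms -> nat -> R) (T : nat) : R :=
  \sum_(1 <= t < T.+1) r (play r t) t.

Definition mean (F : probability R R) : R := fine (\int[F]_x x%:E)%E.
Definition subgaussian1 (F : probability R R) : Prop :=
  forall lam : R,
    (\int[F]_x (expR (lam * (x - mean F)))%:E <= (expR (lam ^+ 2 / 2))%:E)%E.

Definition indep_rounds d (Omega : measurableType d) (P : probability Omega R)
    (X : Arms -> nat -> {RV P >-> R}) : Prop :=
  forall (S : seq nat) (B : nat -> Arms -> set R),
    uniq S -> (forall t a, measurable (B t a)) ->
    P (\bigcap_(t in [set t | t \in S]) \bigcap_(a in [set: Arms])
         (X a t @^-1` B t a))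
    = (\prod_(t <- S) P (\bigcap_(a in [set: Arms]) (X a t @^-1` B t a)))%E.

Definition mu_star (mu : Arms -> R) : R :=
  \big[Num.max/mu (init_tuple 1)]_(a : Arms) mu a.

End MUCB.

(* Main.v *)
(* The regret is the expected sum of the gaps of the played tuples: the tuple
   played at round [t + 1] is a function of the rewards of rounds [<= t], which
   are independent of the rewards of round [t + 1].  Once the initial phase is
   over, a tuple whose gap exceeds [eps], already played [(2 + sqrt 2)^2 ln T /
   gap^2] times, is played only if its own average is too large by
   [sqrt (2 ln T / n)] or the index of the best tuple is below its mean.
   Averages are taken over adaptively chosen rounds, so the deviation
   bounds come from an exponential supermartingale, frozen at the [s]-th play of
   the tuple.  Overestimation is counted once for each number [s] of previous
   plays, at cost [1 / T] each by the subgaussian hypothesis, hence at most 1 per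
   tuple.  For underestimation at round [t] the constant 1 of the hypothesis
   would only give probability [1 / t], whose sum over [t] is logarithmic; for
   rewards in [0, 1] the variance is at most 1/4, which gives [1 / t^2] and a
   total of at most 1.  With [N] for the initial phase and one more unit per
   tuple for rounding up, everything fits in [3 N]. *)
Require Import Defs.
From HB Require Import structures.
From mathcomp Require Import all_boot all_order all_algebra.
From mathcomp Require Import all_classical all_reals all_analysis.
From mathcomp Require Import measurable_realfun.
From mathcomp Require Import ring lra.
Set Implicit Arguments. Unset Strict Implicit. Unset Printing Implicit Defensive.
Import Order.TTheory GRing.Theory Num.Theory.
Import numFieldNormedType.Exports.
Local Open Scope classical_set_scope.
Local Open Scope ring_scope.

(** * Lexicographic order and runs of the algorithm *)

Section LexOrder.
Variables (M : nat) (K : 'I_M -> nat).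
Implicit Types a b c : Arms K.

Lemma lex_ltP a b : reflect
  (exists2 n : 'I_M, (forall j : 'I_M, (j < n)%N -> a j = b j) & (a n < b n)%N)
  (lex_lt a b).
Proof.
apply: (iffP existsP) => [[n /andP[/forallP ab lt_ab]]|[n ab lt_ab]].
  by exists n => // j jn; apply/eqP; have /implyP := ab j; exact.
exists n; rewrite lt_ab andbT; apply/forallP => j; apply/implyP => jn.
by rewrite ab.
Qed.

Lemma lex_lt_irr : irreflexive (@lex_lt M K).
Proof. by move=> a; case: lex_ltP => // -[n _]; rewrite ltnn. Qed.

Lemma lex_lt_trans : transitive (@lex_lt M K).
Proof.
move=> b a c /lex_ltP[n abn ltn] /lex_ltP[m bcm ltm]; apply/lex_ltP.
case: (ltngtP n m) => [nm|mn|/ord_inj nm].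
- by exists n => [j jn|]; [rewrite abn// bcm// (ltn_trans jn)|rewrite -bcm].
- by exists m => [j jm|]; [rewrite abn ?bcm// (ltn_trans jm)|rewrite abn].
- subst m; exists n => [j jn|]; first by rewrite abn// bcm.
  exact: ltn_trans ltn ltm.
Qed.

(** The first coordinate at which the tuples differ decides. *)
Lemma lex_lt_total a b : a != b -> lex_lt a b || lex_lt b a.
Proof.
move=> ab; have [n0 n0P] : exists n, a n != b n.
  apply/existsP; rewrite -negb_forall; apply: contra ab => /forallP ab.
  by apply/eqP/ffunP => n; apply/eqP.
case: (@arg_minnP _ n0 (fun n => a n != b n) val n0P) => n nP nmin.
have agree (j : 'I_M) : (j < n)%N -> a j = b j.
  by move=> jn; apply/eqP; apply: contraTT jn => /nmin; rewrite -leqNgt.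
have := nP; rewrite -(inj_eq val_inj) /= neq_ltn => /orP[lt_ab|lt_ba].
  by apply/orP; left; apply/lex_ltP; exists n.
by apply/orP; right; apply/lex_ltP; exists n => // j /agree.
Qed.

Lemma lex_le_refl : reflexive (@lex_le M K).
Proof. by move=> a; rewrite /lex_le eqxx. Qed.

Lemma lex_le_trans : transitive (@lex_le M K).
Proof.
move=> b a c; rewrite /lex_le => /orP[/eqP->//|ab] /orP[/eqP<-|bc].
  by rewrite ab orbT.
by rewrite (lex_lt_trans ab bc) orbT.
Qed.

Lemma lex_le_total : total (@lex_le M K).
Proof.
move=> a b; rewrite /lex_le; case: (eqVneq a b) => [//|ab] /=.
exact: lex_lt_total.
Qed.

Lemma lex_le_anti : antisymmetric (@lex_le M K).
Proof.
move=> a b; rewrite /lex_le; case: (eqVneq a b) => [//|ab] /=.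
by move=> /andP[/lex_lt_trans h /h]; rewrite lex_lt_irr.
Qed.

End LexOrder.

Section Run.
Variables (M : nat) (K : 'I_M -> nat) (Kpos : forall i, (0 < K i)%N).
Variable R : realType.
Implicit Types (r : Arms K -> nat -> R) (h : seq (Arms K)) (a b : Arms K).

Lemma Nprod_card : Nprod K = #|{: Arms K}|.
Proof.
rewrite card_dep_ffun foldrE big_map big_enum /=.
by apply: eq_bigr => i _; rewrite card_ord.
Qed.

Lemma Nprod_gt0 : (0 < Nprod K)%N.
Proof. exact: prodn_gt0. Qed.

(** Turns the choice into comparisons of indices, usable both for measurability and for the regret.
    The conditions hold for exactly one tuple, so [pick] must return it and the default is never
    reached. *)
Lemma ucb_choiceP r h t a :
  reflect ((forall b, (ucb_index r h t b <= ucb_index r h t a)%E) /\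
           (forall b, ucb_index r h t b = ucb_index r h t a -> lex_le a b))
          (ucb_choice Kpos r h t == a).
Proof.
pose Q a := [forall b, (ucb_index r h t b <= ucb_index r h t a)%E]
            && [forall b, (ucb_index r h t b == ucb_index r h t a)
                            ==> lex_le a b].
have QP a' : reflect ((forall b, (ucb_index r h t b <= ucb_index r h t a')%E) /\
           (forall b, ucb_index r h t b = ucb_index r h t a' -> lex_le a' b)) (Q a').
  apply: (iffP andP) => [[/forallP H1 /forallP H2]|[H1 H2]]; split=> //.
  - by move=> b /eqP e; have /implyP := H2 b; apply.
  - exact/forallP.
  - by apply/forallP => b; apply/implyP => /eqP; exact: H2.
have Quniq a1 a2 : Q a1 -> Q a2 -> a1 = a2.
  move=> /QP[m1 l1] /QP[m2 l2]; have e : ucb_index r h t a1 = ucb_index r h t a2.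
    by apply/eqP; rewrite eq_le m1 m2.
  by apply: lex_le_anti; rewrite l1// l2.
suff -> : (ucb_choice Kpos r h t == a) = Q a by exact: QP.
have [a0 Qa0] : exists a0, Q a0.
  case: (@arg_maxP _ _ _ (init_tuple Kpos 1) xpredT (ucb_index r h t) isT) => a1 _ a1max.
  pose S := [pred b | ucb_index r h t b == ucb_index r h t a1].
  have Sa1 : S a1 by exact: eqxx.
  (* Among the maximizers of the index, the lexicographic minimum is taken. *)
  case: (extremumP id (@lex_le_refl _ K) (@lex_le_trans _ K) (@lex_le_total _ K) Sa1)
    => a2 /= /eqP e2 min2.
  exists a2; apply/QP; split=> b; rewrite e2; first exact: a1max.
  by move=> /eqP; exact: min2.
have -> : ucb_choice Kpos r h t = a0.
  rewrite /ucb_choice; case: pickP => [a1 /Quniq|/(_ a0)]; first exact.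
  by rewrite -/(Q a0) Qa0.
by apply/eqP/idP => [<-//|]; exact: Quniq.
Qed.

Lemma size_history r t : size (history Kpos r t) = t.
Proof. by elim: t => //= t ih; rewrite size_rcons ih. Qed.

Lemma playS r t : play Kpos r t.+1 = next_play Kpos r (history Kpos r t).
Proof. by rewrite /play /= nth_rcons size_history ltnn eqxx. Qed.

Lemma historyS r t :
  history Kpos r t.+1 = rcons (history Kpos r t) (play Kpos r t.+1).
Proof. by rewrite playS. Qed.

Lemma n_played_rcons h a b : n_played (rcons h b) a = (n_played h a + (b == a))%N.
Proof. by rewrite /n_played -cats1 count_cat /= addn0. Qed.

Lemma n_played_size h a : (n_played h a <= size h)%N.
Proof. exact: count_size. Qed.

Lemma reward_sum_rcons r h a b : reward_sum r (rcons h b) a =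
  reward_sum r h a + (if b == a then r a (size h).+1 else 0).
Proof.
rewrite /reward_sum size_rcons big_mkcond big_ord_recr /= nth_rcons ltnn eqxx.
congr (_ + _); rewrite [RHS]big_mkcond /=; apply: eq_bigr => i _ /=.
by rewrite nth_rcons ltn_ord (set_nth_default b).
Qed.

Lemma total_rewardE r T :
  total_reward Kpos r T = \sum_(t < T) r (play Kpos r t.+1) t.+1.
Proof. by rewrite /total_reward big_add1 /= big_mkord. Qed.

(* Every value of the play counter of [a] is left at most once. *)
Lemma sum_plays r a (f : nat -> R) T :
  \sum_(t < T) (if play Kpos r t.+1 == a then f (n_played (history Kpos r t) a) else 0) =
  \sum_(j < n_played (history Kpos r T) a) f j.
Proof.
elim: T => [|T ih]; first by rewrite !big_ord0.
rewrite big_ord_recr historyS n_played_rcons ih /=.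
by case: eqP => _; rewrite ?addr0 ?addn0// addn1 big_ord_recr.
Qed.

End Run.

(** * A quadratic bound for the exponential *)

Section ExpBounds.
Variable R : realType.

(* [v |-> (1 + v + v^2) exp (-v)] has derivative [v (1 - v) exp (-v)]. *)
Lemma expR_le_quad (v : R) : v <= 1 -> expR v <= 1 + v + v ^+ 2.
Proof.
move=> v1.
pose g := (fun x : R => (1 + x + x ^+ 2) * expR (- x)).
pose dg := (fun x : R => x * (1 - x) * expR (- x)).
have dgE (x : R) : is_derive x 1 g (dg x).
  rewrite /g /dg; apply: is_derive_eq.
  rewrite /GRing.scale /=.
  set e := expR _; ring.
(* Whatever the sign of [v], the mean value point lies between 0 and [v]; hence [c * v >= 0] and
   [c <= 1], which makes [dg c * v] nonnegative. *)
have [c cv gc] : exists2 c : R, c <= 1 /\ 0 <= c * v & g v - g 0 = dg c * v.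
  have gcont (x : R) : {for x, continuous g}.
    by apply: differentiable_continuous; apply/derivable1_diffP.
  have [v0|v0] := leP 0 v.
    have [|c] := @MVT_segment R g dg 0 v v0 (fun x _ => dgE x).
      by apply: continuous_subspaceT => x; exact: gcont.
    rewrite in_itv /= subr0 => /andP[c0 cv] ?; exists c => //.
    by split; [exact: le_trans v1|exact: mulr_ge0].
  have [|c] := @MVT_segment R g dg v 0 (ltW v0) (fun x _ => dgE x).
    by apply: continuous_subspaceT => x; exact: gcont.
  rewrite in_itv /= => /andP[vc c0] gc; exists c.
    by split; [exact: le_trans ler01|rewrite mulr_le0// ltW].
  by rewrite -opprB gc sub0r mulrN opprK.
have gv : 1 <= g v.
  rewrite -subr_ge0; have -> : 1 = g 0 by rewrite /g oppr0 expR0; ring.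
  rewrite gc /dg; case: cv => c1 cv0.
  have -> : c * (1 - c) * expR (- c) * v = (c * v) * (1 - c) * expR (- c) by ring.
  by rewrite mulr_ge0 ?expR_ge0// mulr_ge0// subr_ge0.
by move: gv; rewrite /g expRN ler_pdivlMr ?expR_gt0// mul1r.
Qed.

End ExpBounds.

(** * Independence of the past and the next round *)

Section Independence.
Local Open Scope ereal_scope.
Context d d1 d2 (T : measurableType d) (E1 : measurableType d1)
  (E2 : measurableType d2) (R : realType) (P : probability T R).
Variables (U : T -> E1) (V : T -> E2).
Hypotheses (mU : measurable_fun setT U) (mV : measurable_fun setT V).
Hypothesis indepUV : forall A B, measurable A -> measurable B ->
  P (U @^-1` A `&` V @^-1` B) = P (U @^-1` A) * P (V @^-1` B).

(** The joint law of [(U, V)] agrees with the product of the marginal laws on rectangles, hence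
    everywhere; Tonelli then separates the integrals. *)
Lemma ge0_integralM_indep (f : E1 -> \bar R) (g : E2 -> \bar R) :
  measurable_fun setT f -> measurable_fun setT g ->
  (forall x, 0 <= f x) -> (forall y, 0 <= g y) ->
  \int[P]_w (f (U w) * g (V w)) = \int[P]_w f (U w) * \int[P]_w g (V w).
Proof.
move=> mf mg f0 g0.
have mUV : measurable_fun setT (fun w => (U w, V w)) by exact: measurable_fun_pair.
pose U' : {mfun T >-> E1} := mfun_Sub (mem_set mU).
pose V' : {mfun T >-> E2} := mfun_Sub (mem_set mV).
pose UV' : {mfun T >-> (E1 * E2)%type} := mfun_Sub (mem_set mUV).
pose h := fun z : E1 * E2 => f z.1 * g z.2.
have mh : measurable_fun setT h.
  by apply: emeasurable_funM; apply: measurableT_comp.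
have h0 z : 0 <= h z by rewrite mule_ge0.
have prodE X : measurable X ->
    (distribution P U' \x distribution P V') X = distribution P UV' X.
  by apply: product_measure_unique => A B mA mB; rewrite /= -indepUV.
transitivity (\int[distribution P UV']_z h z).
  by rewrite ge0_integral_distribution.
transitivity (\int[distribution P U' \x distribution P V']_z h z).
  by apply: eq_measure_integral => A mA _; exact: esym (prodE A mA).
rewrite fubini_tonelli1//= /fubini_F.
transitivity (\int[distribution P U']_x (f x * \int[distribution P V']_y g y)).
  apply: eq_integral => x _ /=.
  by rewrite -ge0_integralZl//.
rewrite ge0_integralZr//; last exact: integral_ge0.
by rewrite !ge0_integral_distribution.
Qed.

End Independence.

Section Past.
Context (R : realType) (M : nat) (K : 'I_M -> nat) (d : measure_display)
  (Omega : measurableType d) (P : probability Omega R)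
  (X : Arms K -> nat -> {RV P >-> R}).

(** A pi-system generating the information of the rounds up to [n]. It involves the rewards of all
    tuples, played or not, and so does not depend on the algorithm. *)
Definition past (n : nat) : set (set Omega) :=
  [set A | exists2 B : nat -> Arms K -> set R, (forall t a, measurable (B t a)) &
    A = \bigcap_(t in [set t | (t <= n)%N])
          \bigcap_(a in [set: Arms K]) (X a t @^-1` B t a)].

Local Notation past_space n := (g_sigma_algebraType (past n)).

Lemma set_iota n : [set t | t \in iota 0 n.+1] = [set t | (t <= n)%N].
Proof. by apply/seteqP; split=> t /=; rewrite -[_ :: _]/(iota 0 n.+1) mem_iota. Qed.

Lemma past_setI n : setI_closed (past n).
Proof.
move=> A1 A2 [B1 mB1 ->] [B2 mB2 ->].
exists (fun t a => B1 t a `&` B2 t a).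
  by move=> t a; exact: measurableI.
rewrite -bigcapI; apply: eq_bigcapr => t _.
by rewrite -bigcapI; apply: eq_bigcapr.
Qed.

Lemma measurable_rect (B : nat -> Arms K -> set R) (S : seq nat) :
  (forall t a, measurable (B t a)) ->
  measurable (\bigcap_(t in [set t | t \in S])
                \bigcap_(a in [set: Arms K]) (X a t @^-1` B t a)).
Proof.
move=> mB; apply: fin_bigcap_measurable => [|t _]; first exact: finite_seq.
apply: fin_bigcap_measurable => [|a _]; first exact: finite_finset.
by rewrite -[_ @^-1` _]setTI; exact: measurable_funP.
Qed.

Lemma sub_past n : <<s past n >> `<=` d.-measurable.
Proof.
apply: smallest_sub; first exact: sigma_algebra_measurable.
by move=> _ [B mB ->]; rewrite -set_iota; exact: (measurable_rect (iota 0 n.+1) mB).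
Qed.

Lemma measurable_from_past d' (E : measurableType d') n (f : Omega -> E) :
  measurable_fun setT (f : past_space n -> E) -> measurable_fun setT f.
Proof.
by move=> mf _ B mB; apply: (@sub_past n); exact: mf.
Qed.

Lemma measurable_past n t a : (t <= n)%N ->
  measurable_fun setT (X a t : past_space n -> R).
Proof.
move=> tn _ B mB; rewrite setTI; apply: sub_sigma_algebra.
exists (fun t' a' => if (t' == t) && (a' == a) then B else setT).
  by move=> t' a'; case: ifP.
apply/seteqP; split=> [w Xw t' _ a' _|w /(_ t)].
  by rewrite /=; case: ifP => // /andP[/eqP-> /eqP->].
by move=> /(_ tn) /(_ a Logic.I); rewrite /= !eqxx.
Qed.

Hypothesis indepX : indep_rounds X.

(** Adding the constraint [C] at round [n.+1] to a rectangle of the past gives again a rectangle;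
    [indep_rounds] factors both, and the products differ by one factor. *)
Lemma past_indep_rect n A a C : past n A -> measurable C ->
  P (A `&` X a n.+1 @^-1` C) = (P A * P (X a n.+1 @^-1` C))%E.
Proof.
move=> [B mB ->] mC.
(* The other tuples are unconstrained at round [n.+1], so that this slice is exactly the event on
   [X a n.+1]. *)
pose B' t a' := if t == n.+1 then (if a' == a then C else setT) else B t a'.
have mB' t a' : measurable (B' t a') by rewrite /B'; do 2?case: ifP.
pose slice (B0 : nat -> Arms K -> set R) t :=
  \bigcap_(a' in [set: Arms K]) (X a' t @^-1` B0 t a').
have slice_past t : (t <= n)%N -> slice B' t = slice B t.
  move=> tn; apply: eq_bigcapr => a' _.
  by rewrite /B' ltn_eqF.
have slice_next : slice B' n.+1 = X a n.+1 @^-1` C.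
  apply/seteqP; split=> [w /(_ a Logic.I)|w Xw a' _].
    by rewrite /= /B' !eqxx.
  by rewrite /= /B' eqxx; case: eqP => // ->.
have split_last (B0 : nat -> Arms K -> set R) :
    \bigcap_(t in [set t | (t <= n.+1)%N]) slice B0 t =
    \bigcap_(t in [set t | (t <= n)%N]) slice B0 t `&` slice B0 n.+1.
  apply/seteqP; split=> [w Bw|w [Bw Cw] t /=].
    by split=> [t tn|]; apply: Bw => //=; exact: leqW.
  by rewrite leq_eqVlt => /predU1P[->//|]; exact: Bw.
have past_part : \bigcap_(t in [set t | (t <= n)%N]) slice B' t =
    \bigcap_(t in [set t | (t <= n)%N]) slice B t.
  by apply: eq_bigcapr => t; exact: slice_past.
have := indepX (iota_uniq 0 n.+2) mB'.
have iotaE : iota 0 n.+2 = rcons (iota 0 n.+1) n.+1.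
  by rewrite -cats1 -[n.+2]addn1 iotaD.
rewrite set_iota iotaE big_rcons.
rewrite (eq_big_seq (fun t => P (slice B t))); last first.
  by move=> t; rewrite mem_iota add0n ltnS => /= tn; rewrite -slice_past.
rewrite -(indepX (iota_uniq 0 n.+1) mB) set_iota.
by rewrite -/(slice B' n.+1) -slice_next -past_part -split_last.
Qed.

(** The events independent of [Y] form a Dynkin system containing the pi-system [past n]. *)
Lemma past_indep n A a C : <<s past n >> A -> measurable C ->
  P (X a n.+1 @^-1` C `&` A) = (P (X a n.+1 @^-1` C) * P A)%E.
Proof.
move=> pA mC; set Y := X a n.+1 @^-1` C.
have mY : measurable Y by rewrite /Y -[_ @^-1` _]setTI; exact: measurable_funP.
pose Q (S : set (past_space n)) := P (Y `&` S) = (P Y * P S)%E.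
have PYfin : P Y \is a fin_num by exact: fin_num_measure.
have base S : past n S -> Q S.
  by move=> pS; rewrite /Q setIC muleC; exact: past_indep_rect.
have compl S : <<s past n >> S -> Q S -> Q (~` S).
  move=> /sub_past mS QS; rewrite /Q.
  change (P (Y `&` ~` (S : set Omega)) = P Y * P (~` (S : set Omega)))%E.
  rewrite [in RHS]probability_setC//.
  rewrite muleBr//.
  rewrite mule1 -QS -setDE measureD//.
  by rewrite ltey_eq PYfin.
have union (F : (set (past_space n))^nat) :
    (forall k, <<s past n >> (F k)) -> trivIset setT F ->
    (forall k, Q (F k)) -> Q (\bigcup_k F k).
  move=> mF tF QF; have mF' k := sub_past (mF k).
  rewrite /Q setI_bigcupr.
  rewrite (@measure_bigcup _ _ _ P setT (fun k => Y `&` F k)); last 2 first.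
    by move=> k _; exact: measurableI.
    by apply: trivIset_setIl.
  rewrite (@measure_bigcup _ _ _ P setT F)//.
  rewrite -[in RHS](fineK PYfin) -nneseriesZl//.
  by apply: eq_eseriesr => k _; rewrite fineK//; exact: QF.
apply: (@dynkin_induction _ (past_space n) (past n) Q erefl (@past_setI n) _ base
  compl union _ pA).
by rewrite /Q setIT probability_setT mule1.
Qed.

Lemma ge0_integralM_past n a (G : Omega -> \bar R) (f : R -> \bar R) :
  measurable_fun setT (G : past_space n -> \bar R) -> measurable_fun setT f ->
  (forall w, 0 <= G w)%E -> (forall x, 0 <= f x)%E ->
  (\int[P]_w (G w * f (X a n.+1 w)) =
   \int[P]_w G w * \int[P]_w f (X a n.+1 w))%E.
Proof.
move=> mG mf G0 f0.
(* The past is the identity map from [Omega] to the same set with the coarser sigma-algebra. *)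
apply: (@ge0_integralM_indep _ _ _ Omega (past_space n) R R P idfun (X a n.+1)) => //.
- by move=> _ A mA; rewrite setTI; exact: (@sub_past n).
- move=> A C mA mC; rewrite setIC muleC; exact: past_indep.
Qed.

End Past.

(** * Measurability of the run *)

Section MeasurableRun.
Context (R : realType) (M : nat) (K : 'I_M -> nat) (Kpos : forall i, (0 < K i)%N)
  (d : measure_display) (S : measurableType d) (x : Arms K -> nat -> S -> R) (n : nat).
Hypothesis mx : forall a t, (t <= n)%N -> measurable_fun setT (x a t).
Local Notation r w := (fun a s => x a s w).

Lemma measurable_reward_sum h a : (size h <= n)%N ->
  measurable_fun setT (fun w => reward_sum (r w) h a).
Proof.
move=> hn; rewrite /reward_sum; under eq_fun do rewrite big_mkcond.
apply: measurable_sum => i; case: (nth a h i == a); last exact: measurable_cst.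
by apply: mx; rewrite (leq_trans (ltn_ord i)).
Qed.

Lemma measurable_ucb_index h t a : (size h <= n)%N ->
  measurable_fun setT (fun w => ucb_index (r w) h t a).
Proof.
move=> hn; rewrite /ucb_index; case: eqP => _; first exact: measurable_cst.
apply/measurable_EFinP; apply: measurable_funD; last exact: measurable_cst.
by apply: measurable_funM; [exact: measurable_reward_sum|exact: measurable_cst].
Qed.

Lemma measurable_ucb_choice h t b : (size h <= n)%N ->
  measurable [set w | ucb_choice Kpos (r w) h t = b].
Proof.
move=> hn; have midx := fun a => measurable_ucb_index t a hn.
pose D1 c := [set w | (ucb_index (r w) h t c <= ucb_index (r w) h t b)%E].
pose D2 c := [set w | ucb_index (r w) h t c = ucb_index (r w) h t b -> lex_le b c].
rewrite (_ : [set _ | _] = \bigcap_(c in [set: Arms K]) (D1 c `&` D2 c)); last first.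
  apply/seteqP; split=> [w /eqP/ucb_choiceP[H1 H2] c _|w H].
    by split; [exact: H1|exact: H2].
  by apply/eqP/ucb_choiceP; split=> c; have [] := H c Logic.I.
apply: fin_bigcap_measurable => [|c _]; first exact: finite_finset.
apply: measurableI.
  by rewrite -[D1 c]setTI; exact: measurable_lee.
(* The tie-breaking condition is vacuous if [b] precedes [c], and otherwise says that the two
   indices differ. *)
case: (boolP (lex_le b c)) => bc.
  by rewrite (_ : D2 c = setT)//; apply/seteqP; split=> // w _ _.
rewrite (_ : D2 c = [set w | ucb_index (r w) h t c != ucb_index (r w) h t b]).
  by rewrite -[X in measurable X]setTI; exact: measurable_neqe.
apply/seteqP; split=> w; rewrite /D2 /=.
  by move=> H; apply/eqP => /H; exact/negP.
by move=> /eqP.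
Qed.

(** A history of length [t] reads only rewards of rounds before [t], whence the bound [n.+1]. The
    space [S] is arbitrary so as to cover both [Omega] and the sigma-algebra of the past. *)
Lemma measurable_history t h : (t <= n.+1)%N ->
  measurable [set w | history Kpos (r w) t = h].
Proof.
have triv (Q : Prop) : measurable [set _ : S | Q].
  have [q|q] := pselect Q.
    by rewrite (_ : [set _ | _] = setT)//; apply/seteqP; split.
  by rewrite (_ : [set _ | _] = set0)//; apply/seteqP; split.
elim: t h => [|t ih] h tn; first exact: (triv ([::] = h)).
case/lastP: h => [|h b].
  rewrite (_ : [set _ | _] = set0)//; apply/seteqP; split=> // w /= /(congr1 size).
  by rewrite size_rcons.
have [sh|sh] := eqVneq (size h) t; last first.
  rewrite (_ : [set _ | _] = set0)//; apply/seteqP; split=> // w /= /rcons_inj[= hE _].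
  by move: sh; rewrite -hE size_history eqxx.
rewrite (_ : [set _ | _] = [set w | history Kpos (r w) t = h] `&`
    [set w | next_play Kpos (r w) h = b]); last first.
  apply/seteqP; split=> [w /= /rcons_inj[= -> ->]//|w /= [-> ->]//].
apply: measurableI; first exact/ih/ltnW.
rewrite /next_play /=; case: ((size h).+1 <= Nprod K)%N; first exact: triv.
by apply: measurable_ucb_choice; rewrite sh -ltnS.
Qed.

(** Histories are countably many, so a function of the random history can be cut along the events
    that fix it. *)
Lemma measurable_fun_history d' (E : measurableType d') t
    (phi : seq (Arms K) -> S -> E) : (t <= n.+1)%N ->
  (forall h, size h = t -> measurable_fun setT (phi h)) ->
  measurable_fun setT (fun w => phi (history Kpos (r w) t) w).
Proof.
move=> tn mphi _ B mB; rewrite setTI.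
rewrite (_ : _ @^-1` _ = \bigcup_(h in [set: seq (Arms K)])
   (if size h == t then [set w | history Kpos (r w) t = h] `&` phi h @^-1` B
    else set0)); last first.
  apply/seteqP; split=> [w Bw|w [h _]].
    by exists (history Kpos (r w) t) => //; rewrite size_history eqxx.
  by case: eqP => //= _ [<-].
apply: countable_bigcupT_measurable => [|h]; first exact: countableP.
case: eqP => // sh; apply: measurableI; first exact: measurable_history.
by rewrite -[X in measurable X]setTI; exact: mphi.
Qed.

End MeasurableRun.

(** * Exponential supermartingale *)

Section ExpMartingale.
Context (R : realType) (M : nat) (K : 'I_M -> nat) (Kpos : forall i, (0 < K i)%N).
Variables (m lam psi : R) (a : Arms K) (s : nat).
Implicit Types r : Arms K -> nat -> R.

(* Only the first [s] plays of [a] contribute, so that the process is frozen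
   from the [s]-th play on and no maximal inequality is needed. *)
Fixpoint expmart r (t : nat) : R :=
  if t is t'.+1 then
    expmart r t' *
    (if (play Kpos r t == a) && (n_played (history Kpos r t') a < s)%N
     then expR (lam * (r a t - m) - psi) else 1)
  else 1.

Lemma expmart_ge0 r t : 0 <= expmart r t.
Proof.
by elim: t => //= t ih; rewrite mulr_ge0//; case: ifP => _ //; exact: expR_ge0.
Qed.

Lemma expmartE r t : (n_played (history Kpos r t) a <= s)%N ->
  expmart r t = expR (lam * (reward_sum r (history Kpos r t) a
                             - (n_played (history Kpos r t) a)%:R * m)
                      - (n_played (history Kpos r t) a)%:R * psi).
Proof.
elim: t => [|t ih]; first by rewrite /= /reward_sum big_ord0 !mul0r !subr0 mulr0 expR0.
rewrite historyS n_played_rcons reward_sum_rcons size_history /=.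
case: eqP => /= _; last by rewrite addn0 addr0 mulr1.
rewrite addn1 => ns; rewrite ns ih 1?ltnW// -expRD; congr expR.
by rewrite -natr1; ring.
Qed.

Lemma expmart_frozen r t T : (t <= T)%N ->
  n_played (history Kpos r t) a = s -> expmart r T = expmart r t.
Proof.
(* The induction must also carry that the counter stays at least [s], which makes all later factors
   1. *)
move=> tT nt; suff : (s <= n_played (history Kpos r T) a)%N /\ expmart r T = expmart r t.
  by case.
elim: T tT => [|T ih]; first by rewrite leqn0 => /eqP t0; rewrite t0 in nt *; rewrite nt.
rewrite leq_eqVlt => /predU1P[<-|/ih[sT <-]]; first by rewrite nt.
rewrite historyS n_played_rcons /= ltnNge sT andbF mulr1; split=> //.
by rewrite (leq_trans sT)// leq_addr.
Qed.

End ExpMartingale.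

Section MeasurableExpMart.
Context (R : realType) (M : nat) (K : 'I_M -> nat) (Kpos : forall i, (0 < K i)%N)
  (d : measure_display) (S : measurableType d) (x : Arms K -> nat -> S -> R) (n : nat).
Hypothesis mx : forall a t, (t <= n)%N -> measurable_fun setT (x a t).
Local Notation r w := (fun a s => x a s w).

Lemma measurable_play t a : (t <= n)%N ->
  measurable_fun setT (fun w => play Kpos (r w) t.+1 == a).
Proof.
move=> tn.
exact: (@measurable_fun_history _ _ _ Kpos _ _ _ _ mx _ _ t.+1
  (fun h _ => nth (init_tuple Kpos 1) h t == a)).
Qed.

Lemma measurable_n_played t a (p : pred nat) : (t <= n)%N ->
  measurable_fun setT (fun w => p (n_played (history Kpos (r w) t) a)).
Proof.
move=> tn; apply: (@measurable_fun_history _ _ _ Kpos _ _ _ _ mx _ _ t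
  (fun h _ => p (n_played h a))) => //; exact: leqW.
Qed.

Lemma measurable_expmart m lam psi a s t : (t <= n)%N ->
  measurable_fun setT (fun w => expmart Kpos m lam psi a s (r w) t).
Proof.
elim: t => [|t ih] tn /=; first exact: measurable_cst.
apply: measurable_funM; first exact/ih/ltnW.
apply: measurable_fun_ifT; last exact: measurable_cst.
  apply: measurable_and; first exact/measurable_play/ltnW.
  by apply: (@measurable_n_played t a (fun k => k < s)%N); exact: ltnW.
apply: measurableT_comp => //; apply: measurable_funB => //.
by apply: measurable_funM => //; apply: measurable_funB => //; exact: mx.
Qed.

End MeasurableExpMart.

(** * Deviation bounds uniform in time *)

Section Concentration.
Context (R : realType) (M : nat) (K : 'I_M -> nat) (Kpos : forall i, (0 < K i)%N)
  (d : measure_display) (Omega : measurableType d) (P : probability Omega R)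
  (F : Arms K -> probability R R) (X : Arms K -> nat -> {RV P >-> R}).
Hypothesis lawX : forall a t (B : set R), measurable B -> P (X a t @^-1` B) = F a B.
Hypothesis indepX : indep_rounds X.
Local Notation r w := (fun a s => X a s w).

Lemma integral_law a t (f : R -> \bar R) :
  measurable_fun setT f -> (forall x, 0 <= f x)%E ->
  (\int[P]_w f (X a t w) = \int[F a]_x f x)%E.
Proof.
move=> mf f0; rewrite -[LHS](ge0_integral_distribution (X a t) mf f0).
by apply: eq_measure_integral => A mA _; exact: lawX.
Qed.

(** Whether a new factor enters is decided by the past, and the fresh reward is independent of it;
    its exponential moment is at most [expR psi], which the [- psi] in the exponent compensates. *)
Lemma expectation_expmart m lam psi a s t :
  (\int[F a]_x (expR (lam * (x - m)))%:E <= (expR psi)%:E)%E ->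
  (\int[P]_w (expmart Kpos m lam psi a s (r w) t)%:E <= 1)%E.
Proof.
move=> mgf; elim: t => [|t ih] /=.
  by rewrite integral_cst//= mul1e probability_le1.
pose sel w := (play Kpos (r w) t.+1 == a) &&
              (n_played (history Kpos (r w) t) a < s)%N.
pose V w := expmart Kpos m lam psi a s (r w) t.
pose f x := expR (lam * (x - m)).
(* The current value is [G0 + G1 * expR psi] and the next one [G0 + G1 * f (X a t.+1)], with [G0]
   and [G1] measurable for the past. *)
pose G0 w := if sel w then 0 else V w.
pose G1 w := if sel w then V w * expR (- psi) else 0.
have V0 w : 0 <= V w by exact: expmart_ge0.
have G00 w : 0 <= G0 w by rewrite /G0; case: ifP.
have G10 w : 0 <= G1 w by rewrite /G1; case: ifP => // _; rewrite mulr_ge0// expR_ge0.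
have mpast b u : (u <= t)%N ->
    measurable_fun setT (X b u : g_sigma_algebraType (past X t) -> R).
  exact: measurable_past.
have mV : measurable_fun setT (V : g_sigma_algebraType (past X t) -> R).
  exact: (measurable_expmart Kpos mpast).
have msel : measurable_fun setT (sel : g_sigma_algebraType (past X t) -> bool).
  apply: measurable_and; first exact: (measurable_play Kpos mpast).
  exact: (measurable_n_played Kpos mpast _ (fun k => k < s)%N).
have mG0 : measurable_fun setT (G0 : g_sigma_algebraType (past X t) -> R).
  exact: measurable_fun_ifT.
have mG1 : measurable_fun setT (G1 : g_sigma_algebraType (past X t) -> R).
  by apply: measurable_fun_ifT => //; exact: measurable_funM.
have mf : measurable_fun setT f.
  apply: measurableT_comp => //; apply: measurable_funM => //.
  exact: measurable_funB.
have mX := measurable_funP (X a t.+1).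
have mG0' : measurable_fun setT G0 by exact: measurable_from_past mG0.
have mG1' : measurable_fun setT G1 by exact: measurable_from_past mG1.
have GV w : ((G0 w)%:E + (G1 w)%:E * (expR psi)%:E = (V w)%:E)%E.
  rewrite -EFinM -EFinD /G0 /G1; case: ifP => _; last by rewrite mul0r addr0.
  by rewrite add0r -mulrA -expRD addNr expR0 mulr1.
rewrite (eq_integral (fun w => (G0 w)%:E + (G1 w)%:E * (f (X a t.+1 w))%:E)%E); last first.
  move=> w _; rewrite -EFinM -EFinD -/(V w) -/(sel w) /G0 /G1; congr EFin.
  case: ifP => _; last by rewrite mul0r addr0 mulr1.
  by rewrite add0r -mulrA -expRD addrC.
apply: le_trans ih; rewrite -/(\int[P]_w (V w)%:E)%E.
rewrite [leRHS](eq_integral (fun w => (G0 w)%:E + (G1 w)%:E * (expR psi)%:E)%E); last first.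
  by move=> w _; rewrite GV.
have eG0 : measurable_fun setT (fun w => (G0 w)%:E) by exact/measurable_EFinP.
have eG1 : measurable_fun setT (fun w => (G1 w)%:E) by exact/measurable_EFinP.
have eX : measurable_fun setT (fun w => (f (X a t.+1 w))%:E).
  by apply/measurable_EFinP; exact: measurableT_comp.
have f0 y : (0 <= (f y)%:E)%E by rewrite lee_fin expR_ge0.
have eG00 w : (0 <= (G0 w)%:E)%E by rewrite lee_fin.
have eG10 w : (0 <= (G1 w)%:E)%E by rewrite lee_fin.
have epsi0 : (0 <= (expR psi)%:E)%E by rewrite lee_fin expR_ge0.
rewrite ge0_integralD//; last 2 first.
- by move=> w _; exact: mule_ge0.
- exact: emeasurable_funM.
rewrite ge0_integralD//; last 2 first.
- by move=> w _; exact: mule_ge0.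
- by apply: emeasurable_funM => //; exact: measurable_cst.
rewrite leeD2l//.
rewrite (@ge0_integralM_past _ _ _ _ _ P X indepX t a (EFin \o G1) (EFin \o f))//; last 2 first.
- exact/measurable_EFinP.
- exact/measurable_EFinP.
rewrite ge0_integralZr//.
apply: lee_wpmul2l; first by apply: integral_ge0 => w _; exact: eG10.
rewrite (integral_law a t.+1 (f := EFin \o f))//.
exact/measurable_EFinP.
Qed.

(** The sign of [lam] selects the tail, and [c] is the threshold already multiplied by [lam]. The
    unknown round [t] lets one event cover every time at which the count of [a] equals [s]. *)
Definition deviation (m lam c : R) (a : Arms K) (s T : nat) : set Omega :=
  [set w | exists2 t, (t <= T)%N &
    n_played (history Kpos (r w) t) a = s /\
    c <= lam * (reward_sum (r w) (history Kpos (r w) t) a - s%:R * m)].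

Lemma measurable_deviation m lam c a s T : measurable (deviation m lam c a s T).
Proof.
have mX b u : (u <= T)%N -> measurable_fun setT (X b u) by move=> _; exact: measurable_funP.
pose E h w := (n_played h a == s) && (c <= lam * (reward_sum (r w) h a - s%:R * m)).
rewrite (_ : deviation _ _ _ _ _ _ =
  \bigcup_(t in [set t | (t <= T)%N]) [set w | E (history Kpos (r w) t) w]); last first.
  apply/seteqP; split=> w /= [t tT].
    by move=> [nt ct]; exists t => //=; rewrite /E nt eqxx.
  by move=> /andP[/eqP nt ct]; exists t.
apply: bigcup_measurable => t tT.
rewrite -[X in measurable X]setTI.
rewrite (_ : [set w | _] = (fun w => E (history Kpos (r w) t) w) @^-1` [set true]).
  apply: (@measurable_fun_history _ _ _ Kpos _ _ _ T mX _ _ t E) => //; first exact: leqW.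
  move=> h sh; apply: measurable_and; first exact: measurable_cst.
  apply: measurable_fun_ler; first exact: measurable_cst.
  apply: measurable_funM => //; apply: measurable_funB => //.
  by apply: (@measurable_reward_sum _ _ _ _ _ _ _ mX); rewrite sh.
by apply/seteqP; split=> w /=.
Qed.

Lemma deviation_bound m lam psi c a s T :
  (\int[F a]_x (expR (lam * (x - m)))%:E <= (expR psi)%:E)%E ->
  (P (deviation m lam c a s T) <= (expR (s%:R * psi - c))%:E)%E.
Proof.
move=> mgf; set D := deviation _ _ _ _ _ _.
have mD : measurable D by exact: measurable_deviation.
have mX b u : (u <= T)%N -> measurable_fun setT (X b u) by move=> _; exact: measurable_funP.
have key : ((expR (c - s%:R * psi))%:E * P D <= 1)%E.
  apply: le_trans (expectation_expmart s T mgf).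
  have mI : measurable_fun setT (fun w => (\1_D w : R)%:E).
    by apply/measurable_EFinP; exact: measurable_indic.
  have I0 w : setT w -> (0 <= (\1_D w : R)%:E)%E by rewrite lee_fin.
  have e0 : (0 <= (expR (c - s%:R * psi))%:E)%E by rewrite lee_fin expR_ge0.
  rewrite -[in leLHS](setIT D) -integral_indic// -(ge0_integralZl _ _ mI I0 e0)//.
  apply: ge0_le_integral => //.
  - by apply: emeasurable_funM => //; exact: measurable_cst.
  - by apply/measurable_EFinP; exact: (measurable_expmart Kpos mX).
  - move=> w _; rewrite -EFinM lee_fin indicE.
    have [wD|_] := boolP (w \in D); last by rewrite mulr0 expmart_ge0.
    rewrite mulr1; case: (set_mem wD) => t tT [nt ct].
    by rewrite (expmart_frozen m lam psi tT nt) expmartE ?nt// ler_expR lerB.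
have PDfin : P D \is a fin_num by exact: fin_num_measure.
move: key; rewrite -(fineK PDfin) -EFinM !lee_fin => key.
by rewrite -opprB expRN -[leRHS]mul1r ler_pdivlMr ?expR_gt0// mulrC.
Qed.

End Concentration.

(** * Laws on the unit interval *)

Section Clamp.
Variable R : realType.

(** The laws give [0, 1] mass one but samples may leave it on a null set; clamping makes the bounds
    hold everywhere without changing integrals. *)
Definition clamp (x : R) : R := Num.max 0 (Num.min x 1).

Lemma clamp_ge0 x : 0 <= clamp x.
Proof. by rewrite /clamp le_max lexx. Qed.

Lemma clamp_le1 x : clamp x <= 1.
Proof. by rewrite /clamp ge_max ler01 ge_min lexx orbT. Qed.

Lemma clamp_id x : 0 <= x <= 1 -> clamp x = x.
Proof. by move=> /andP[x0 x1]; rewrite /clamp min_l// max_r. Qed.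

Lemma measurable_clamp : measurable_fun setT clamp.
Proof.
apply: measurable_maxr; first exact: measurable_cst.
by apply: measurable_minr; [exact: measurable_id|exact: measurable_cst].
Qed.

End Clamp.

Section UnitIntervalLaw.
Context (R : realType) (F : probability R R).
Hypothesis F01 : F `[0, 1]%classic = 1%E.

Let F01C : F (~` `[0, 1]%classic) = 0%E.
Proof. by rewrite probability_setC// F01 subee. Qed.

Lemma integral_clamp (g : R -> \bar R) : measurable_fun setT g ->
  (\int[F]_x g x = \int[F]_x g (clamp x))%E.
Proof.
move=> mg; apply: ae_eq_integral => //.
  by apply: measurableT_comp => //; exact: measurable_clamp.
exists (~` `[0, 1]%classic); split => //; first exact: measurableC.
move=> x; apply: contra_not => /=; rewrite in_itv /= => x01 _.
by rewrite clamp_id.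
Qed.

Lemma integrable_clamp : F.-integrable setT (fun x => (clamp x)%:E).
Proof.
apply: (measurable_bounded_integrable _ _ (@measurable_clamp R)) => //.
  by rewrite ltey_eq fin_num_measure.
exists 1; split => // M M1 x _ /=.
by rewrite ger0_norm ?clamp_ge0// (le_trans (clamp_le1 x))// ltW.
Qed.

Lemma mean_clamp : (mean F)%:E = (\int[F]_x (clamp x)%:E)%E.
Proof.
rewrite /mean (integral_clamp (g := EFin)); last exact/measurable_EFinP.
by rewrite fineK//; exact: integrable_fin_num integrable_clamp.
Qed.

Lemma mean_ge0 : 0 <= mean F.
Proof.
by rewrite -lee_fin mean_clamp integral_ge0// => x _; rewrite lee_fin clamp_ge0.
Qed.

Lemma mean_le1 : mean F <= 1.
Proof.
rewrite -lee_fin mean_clamp; apply: (@le_trans _ _ (\int[F]_x (cst 1 x))%E).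
  apply: ge0_le_integral => //.
  - by move=> x _; rewrite lee_fin clamp_ge0.
  - by apply/measurable_EFinP; exact: measurable_clamp.
  - by move=> x _; rewrite lee_fin clamp_le1.
by rewrite integral_cst//= mul1e probability_le1.
Qed.

Lemma integral_affine_clamp (A B : R) :
  (\int[F]_x (A + B * clamp x)%:E = (A + B * mean F)%:E)%E.
Proof.
under eq_integral do rewrite EFinD EFinM.
rewrite integralD//=; last 2 first.
- exact: (finite_measure_integrable_cst F A measurableT).
- exact: integrableZl integrable_clamp.
rewrite integralZl//; last exact: integrable_clamp.
by rewrite -mean_clamp integral_cst//= probability_setT mule1.
Qed.

Let mexp lam m : measurable_fun setT (fun x : R => (expR (lam * (x - m)))%:E).
Proof.
apply/measurable_EFinP; apply: measurableT_comp => //.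
by apply: measurable_funM => //; exact: measurable_funB.
Qed.

Let mexp_clamp lam m : measurable_fun setT (fun x : R => (expR (lam * (clamp x - m)))%:E).
Proof. by apply: (measurableT_comp (mexp lam m)); exact: measurable_clamp. Qed.

(* For small [L], a quarter of the squared range bounds the variance, which
   improves the subgaussian constant to 1/2. *)
Lemma lower_mgf_le_variance L : 0 <= L <= 1 ->
  (\int[F]_x (expR (- L * (x - mean F)))%:E <= (expR (L ^+ 2 / 4))%:E)%E.
Proof.
move=> /andP[L0 L1]; have m0 := mean_ge0; have m1 := mean_le1.
set m := mean F in m0 m1 *.
(* [A + B * c] is [1 + v + v ^+ 2] at [v = - L * (c - m)] with [c ^+ 2] replaced by the larger [c].
   Being affine, it integrates to a function of the mean. *)
pose A := 1 + L * m + L ^+ 2 * m ^+ 2; pose B := - L + L ^+ 2 * (1 - 2 * m).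
rewrite (integral_clamp (g := fun x => (expR (- L * (x - m)))%:E))//.
apply: (@le_trans _ _ (\int[F]_x (A + B * clamp x)%:E)%E).
  apply: ge0_le_integral => //.
  - apply/measurable_EFinP; apply: measurable_funD => //.
    by apply: measurable_funM => //; exact: measurable_clamp.
  move=> x _; rewrite lee_fin.
  have c0 := clamp_ge0 x; have c1 := clamp_le1 x; set c := clamp x in c0 c1 *.
  apply: le_trans (expR_le_quad _) _; first by nra.
  rewrite -subr_ge0.
  have -> : A + B * c - (1 + - L * (c - m) + (- L * (c - m)) ^+ 2) = L ^+ 2 * (c * (1 - c)).
    by rewrite /A /B; ring.
  by rewrite mulr_ge0 ?sqr_ge0// mulr_ge0// subr_ge0.
rewrite integral_affine_clamp lee_fin -/m.
(* The integral is [1 + L ^+ 2 * (m * (1 - m))], and [m * (1 - m)] is at most 1/4. *)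
apply: le_trans (expR_ge1Dx _).
rewrite -subr_ge0.
have -> : 1 + L ^+ 2 / 4 - (A + B * m) = L ^+ 2 * (m - 1 / 2) ^+ 2.
  by rewrite /A /B; field.
by rewrite mulr_ge0 ?sqr_ge0.
Qed.

(** Rewards are nonnegative almost surely, so the exponent is at most [L * mean F]. This serves
    tilts above 1. *)
Lemma lower_mgf_le_mean L : 0 <= L ->
  (\int[F]_x (expR (- L * (x - mean F)))%:E <= (expR (L * mean F))%:E)%E.
Proof.
move=> L0; rewrite (integral_clamp (g := fun x => (expR (- L * (x - mean F)))%:E))//.
apply: (@le_trans _ _ (\int[F]_x (cst (expR (L * mean F))%:E x))%E).
  apply: ge0_le_integral => //.
  - move=> x _; rewrite lee_fin ler_expR.
    by have := mulr_ge0 L0 (clamp_ge0 x); lra.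
by rewrite integral_cst//= probability_setT mule1.
Qed.

End UnitIntervalLaw.

(** * Regret decomposition *)

Section RegretDecomposition.
Context (R : realType) (M : nat) (K : 'I_M -> nat) (Kpos : forall i, (0 < K i)%N).
Implicit Types (r : Arms K -> nat -> R) (a : Arms K).

(** If the last index [n] is counted, it is 0 or below [u], and the trivial bound [n.+1] on the sum
    suffices. The extra 1 pays for rounding up. *)
Lemma sum_initial_counts (u : R) n : 0 <= u ->
  \sum_(j < n) (if (j%:R < u) || (j == 0 :> nat) then 1 else 0) <= u + 1.
Proof.
move=> u0; elim: n => [|n ih]; first by rewrite big_ord0 addr_ge0.
rewrite big_ord_recr /=; case: ifP => [nu|_]; last by rewrite addr0.
apply: (@le_trans _ _ n.+1%:R); last first.
  by case/orP: nu => [/ltW nu|/eqP->]; rewrite -natr1 ?lerD2r// add0r lerDr.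
rewrite -natr1 lerD2r.
have : \sum_(j < n) (if (j%:R < u) || (j == 0 :> nat) then 1 else 0) <= \sum_(j < n) 1 :> R.
  by apply: ler_sum => j _; case: ifP.
by rewrite sumr_const card_ord.
Qed.

(** The deterministic accounting: each late round with a large gap is charged to a small count, to
    [o] or to [v]. Since [o] is indexed by the count of the played tuple, each of its terms is
    charged at most once; [v] is indexed by the round. *)
Lemma regret_pointwise r T (Delta u : Arms K -> R) (eps : R)
    (o : Arms K -> nat -> R) (v : nat -> nat -> R) :
  0 <= eps -> (forall a, Delta a <= 1) -> (forall a, 0 <= u a) ->
  (forall a j, 0 <= o a j) -> (forall t j, 0 <= v t j) ->
  (forall t, (Nprod K <= t < T)%N ->
     let a := play Kpos r t.+1 in let j := n_played (history Kpos r t) a in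
     eps < Delta a ->
     [\/ j%:R < u a, j = 0%N, (0 < j)%N /\ 1 <= o a j |
         exists2 s, (1 <= s < t.+1)%N & 1 <= v t s]) ->
  \sum_(t < T) Delta (play Kpos r t.+1) <=
    (Nprod K)%:R + T%:R * eps
    + \sum_(a | eps < Delta a) (Delta a * (u a + 1) + \sum_(1 <= j < T) o a j)
    + \sum_(Nprod K <= t < T) \sum_(1 <= s < t.+1) v t s.
Proof.
move=> eps0 Delta1 u0 o0 v0 step.
pose f a j : R := Delta a * (if (j%:R < u a) || (j == 0 :> nat) then 1 else 0)
                  + (if (0 < j)%N then o a j else 0).
pose g t : R := \sum_(1 <= s < t.+1) v t s.
have g0 t : 0 <= g t by exact: sumr_ge0.
have f0 a j : eps < Delta a -> 0 <= f a j.
  move=> /ltW/(le_trans eps0) D0; apply: addr_ge0.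
    by rewrite mulr_ge0//; case: ifP.
  by case: ifP.
pose F t := \sum_(a | eps < Delta a)
  (if play Kpos r t.+1 == a then f a (n_played (history Kpos r t) a) else 0).
have F0 t : 0 <= F t.
  by apply: sumr_ge0 => a ea; case: ifP => // _; exact: f0.
have bound (t : 'I_T) : Delta (play Kpos r t.+1) <=
    (if (t < Nprod K)%N then 1 else 0) + eps + F t
    + (if (Nprod K <= t)%N then g t else 0).
  have [tN|Nt] := ltnP t (Nprod K).
    rewrite addr0 (le_trans (Delta1 _))// -addrA lerDl addr_ge0//.
  rewrite add0r; set a := play _ _ _.
  have [Dle|Dgt] := leP (Delta a) eps.
    by rewrite (le_trans Dle)// -addrA lerDl addr_ge0.
  set j := n_played (history Kpos r t) a.
  have Ft : F t = f a j.
    rewrite /F (bigD1 a)//= eqxx big1 ?addr0// => b /andP[_ ba].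
    by rewrite -/a eq_sym (negbTE ba).
  have D0 : 0 <= Delta a := le_trans eps0 (ltW Dgt).
  have Nt' : (Nprod K <= t < T)%N by rewrite Nt ltn_ord.
  have low : (j%:R < u a) || (j == 0 :> nat) -> Delta a <= eps + F t + g t.
    move=> ju; rewrite Ft /f ju mulr1.
    by case: ifP => _; have := g0 t; have := o0 a j; lra.
  case: (step t Nt' Dgt) => [ju|j0|[j0 oj]|[s st vs]].
  - by apply: low; rewrite ju.
  - by apply: low; apply/orP; right; apply/eqP.
  - apply: (@le_trans _ _ (F t)); last by have := g0 t; lra.
    rewrite Ft /f j0 (le_trans (Delta1 a))// (le_trans oj)// lerDr.
    by rewrite mulr_ge0//; case: ifP.
  - apply: (@le_trans _ _ (g t)); last by have := F0 t; lra.
    rewrite (le_trans (Delta1 a))// (le_trans vs)// /g (bigD1_seq s)/= ?iota_uniq//.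
      by rewrite lerDl sumr_ge0.
    by rewrite mem_index_iota.
apply: (le_trans (ler_sum _ (fun t _ => bound t))).
rewrite !big_split /=; apply: lerD; last first.
  rewrite -(big_mkord xpredT (fun t => if (Nprod K <= t)%N then g t else 0)).
  by rewrite -big_mkcond [leRHS](@big_nat_widenl _ _ _ (Nprod K) 0%N).
apply: lerD; last first.
  rewrite /F exchange_big -big_split /=; apply: ler_sum => a ea.
  (* The sum over rounds becomes a sum over the values of the play counter, which never exceeds
     [T]. *)
  rewrite sum_plays /f big_split /=; apply: lerD.
    rewrite -mulr_sumr ler_wpM2l ?sum_initial_counts//.
    exact: le_trans eps0 (ltW ea).
  have nT : (n_played (history Kpos r T) a <= T)%N.
    by rewrite (leq_trans (n_played_size _ _))// size_history.
  rewrite (big_ord_widen T (fun j => if (0 < j)%N then o a j else 0) nT).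
  rewrite [leRHS](@big_nat_widenl _ _ _ 1%N 0%N)// big_mkord [leLHS]big_mkcond [leRHS]big_mkcond.
  by apply: ler_sum => j _; rewrite andTb; do 2?case: ifP.
rewrite sumr_const card_ord mulr_natl lerD2r.
(* The horizon may end within the initial phase, hence the minimum. *)
suff -> : \sum_(t < T) (if (t < Nprod K)%N then 1 else 0) = (minn T (Nprod K))%:R :> R.
  by rewrite ler_nat geq_minr.
elim: T {step bound F F0 g g0} => [|T ih]; first by rewrite big_ord0 min0n.
rewrite big_ord_recr ih /=; case: ltnP => TN.
  by rewrite natr1 (minn_idPl TN).
by rewrite addr0 (minn_idPr (leqW TN)).
Qed.

End RegretDecomposition.

(** * Numerical estimates and comparison of indices *)

Section Numeric.
Variable R : realType.

(** Telescoping: [1/(n+1)^2] is at most [1/n - 1/(n+1)]. *)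
Lemma sum_inv_sqr (N T : nat) : (0 < N)%N ->
  \sum_(N <= t < T) (t.+1%:R ^+ 2)^-1 <= 1 :> R.
Proof.
move=> N0.
have H n : (N <= n)%N -> \sum_(N <= t < n) (t.+1%:R ^+ 2)^-1 <= N%:R^-1 - n%:R^-1 :> R.
  elim: n => [|n ih]; first by rewrite leqn0 => /eqP n0; rewrite n0 in N0.
  rewrite leq_eqVlt => /predU1P[<-|]; first by rewrite big_geq// subrr.
  rewrite ltnS => Nn; rewrite big_nat_recr//=.
  have n0 : (0 < n)%N by exact: leq_trans Nn.
  apply: (le_trans (lerD (ih Nn) (lexx _))).
  rewrite -subr_ge0.
  have nR : 0 < n%:R :> R by rewrite ltr0n.
  have n1R : 0 < n.+1%:R :> R by rewrite ltr0n.
  have -> : N%:R^-1 - n.+1%:R^-1 - (N%:R^-1 - n%:R^-1 + (n.+1%:R ^+ 2)^-1)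
     = (n%:R * n.+1%:R ^+ 2)^-1 :> R.
    rewrite -natr1 in n1R *.
    by field; rewrite !gt_eqF ?ltr0n.
  by rewrite invr_ge0 mulr_ge0// ?sqr_ge0// ltW.
have [NT|TN] := leqP N T; last by rewrite big_geq// ltnW.
apply: (le_trans (H _ NT)).
have : N%:R^-1 <= 1 :> R by rewrite invf_le1 ?ltr0n// ler1n.
have : 0 <= T%:R^-1 :> R by rewrite invr_ge0.
by lra.
Qed.

End Numeric.

Section Confidence.
Variable R : realType.

(* [6 + 4 sqrt 2 = (2 + sqrt 2)^2]: the gap dominates the confidence radius
   [2 sqrt (L / s)] plus the deviation [sqrt (2 L / s)]. *)
Lemma over_or_under (L l s S m s0 S0 m0 : R) :
  0 <= l <= L -> 0 < s -> 0 < s0 -> m < m0 ->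
  (6 + 4 * Num.sqrt 2) * L / (m0 - m) ^+ 2 <= s ->
  S0 / s0 + Num.sqrt (4 * l / s0) <= S / s + Num.sqrt (4 * l / s) ->
  2 * L <= Num.sqrt (2 * L / s) * (S - s * m) \/
  S0 + s0 * Num.sqrt (4 * l / s0) < s0 * m0.
Proof.
move=> /andP[l0 lL] s_gt0 s0_gt0 mm0 us ucb.
have L0 : 0 <= L := le_trans l0 lL.
have [under|] := ltP (S0 + s0 * Num.sqrt (4 * l / s0)) (s0 * m0); first by right.
move=> not_under; left.
(* In units of [y], the confidence radius is at most [2 * y] and the deviation to be shown is
   [q * y]. *)
set y := Num.sqrt (L / s); set q : R := Num.sqrt 2.
have q0 : 0 <= q by exact: sqrtr_ge0.
have y0 : 0 <= y by exact: sqrtr_ge0.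
have qq : q ^+ 2 = 2 by rewrite sqr_sqrtr.
have yy : y ^+ 2 = L / s by rewrite sqr_sqrtr// divr_ge0// ltW.
have xE : Num.sqrt (2 * L / s) = q * y by rewrite -mulrA sqrtrM.
have rad : Num.sqrt (4 * l / s) <= 2 * y.
  have -> : 2 * y = Num.sqrt (4 * L / s).
    by rewrite -mulrA sqrtrM// [4](_ : _ = 2 ^+ 2) ?sqrtr_sqr ?ger0_norm//; ring.
  by apply: ler_wsqrtr; rewrite ler_wpM2r ?invr_ge0 ?(ltW s_gt0)// ler_wpM2l.
have D0 : 0 < m0 - m by rewrite subr_gt0.
have gap : (2 + q) * y <= m0 - m.
  rewrite -ler_sqr ?nnegrE ?(ltW D0) ?mulr_ge0 ?addr_ge0//.
  rewrite exprMn yy (_ : (2 + q) ^+ 2 = 6 + 4 * q); last first.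
    by rewrite sqrrD qq; ring.
  rewrite [leLHS]mulrA ler_pdivrMr// [leRHS]mulrC.
  by rewrite -ler_pdivrMr ?exprn_gt0.
have opt : m0 <= S0 / s0 + Num.sqrt (4 * l / s0).
  by rewrite -(ler_pM2l s0_gt0) mulrDr mulrCA divff ?gt_eqF// mulr1.
(* The index of the played tuple is at least [m0]; removing the radius leaves an average of at least
   [m0 - 2 * y], hence [m + q * y] by [gap]. *)
have dev : s * (q * y) <= S - s * m.
  have : m + q * y <= S / s.
    by move: gap; rewrite mulrDl; lra.
  by rewrite -(ler_pM2l s_gt0) mulrCA divff ?gt_eqF// mulr1 mulrDr; lra.
rewrite xE; apply: le_trans (ler_wpM2l (mulr_ge0 q0 y0) dev).
have -> : q * y * (s * (q * y)) = q ^+ 2 * (y ^+ 2 * s) by ring.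
by rewrite qq yy divfK ?gt_eqF.
Qed.

End Confidence.

Section Optimal.
Context (R : realType) (M : nat) (K : 'I_M -> nat) (Kpos : forall i, (0 < K i)%N).
Implicit Types r : Arms K -> nat -> R.

Lemma le_mu_star (mu : Arms K -> R) a : mu a <= mu_star Kpos mu.
Proof. exact: le_bigmax. Qed.

Lemma mu_star_attained (mu : Arms K -> R) : exists a, mu_star Kpos mu = mu a.
Proof.
case: (@arg_maxP _ _ _ (init_tuple Kpos 1) xpredT mu isT) => a _ amax.
by exists a; apply/eqP; rewrite eq_le le_mu_star andbT; apply/bigmax_leP; split=> [|b _];
  exact: amax.
Qed.

(** The played tuple has a finite index, which dominates that of [a0]; so the latter is finite too
    and [a0] has been played. The choice [delta = 1/t^2] turns [2 ln (1/delta)] into [4 ln t]. *)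
Lemma play_ucb r t a0 : (Nprod K <= t)%N ->
  let h := history Kpos r t in let a := play Kpos r t.+1 in
  let l := ln t.+1%:R : R in
  (0 < n_played h a)%N ->
  (0 < n_played h a0)%N /\
  reward_sum r h a0 / (n_played h a0)%:R + Num.sqrt (4 * l / (n_played h a0)%:R) <=
  reward_sum r h a / (n_played h a)%:R + Num.sqrt (4 * l / (n_played h a)%:R).
Proof.
move=> Nt h a l na.
have radE : 2 * ln (((t.+1%:R ^+ 2)^-1)^-1) = 4 * l :> R.
  by rewrite invrK lnXn// mulr2n /l; ring.
have : ucb_choice Kpos r h t.+1 == a.
  by rewrite /a playS /next_play size_history ltnNge Nt.
move=> /ucb_choiceP[/(_ a0) + _].
rewrite /ucb_index (gtn_eqF na) radE; case: eqVneq => // n0.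
by rewrite lee_fin lt0n.
Qed.

End Optimal.

(** * Deviation events of mUCB *)

Section NonnegMean.
Context d (Omega : measurableType d) (R : realType) (P : probability Omega R).

(** Measurability and sign are bundled with the bound so that it passes through nested sums. *)
Definition nneg_mean_le (f : Omega -> R) (b : R) : Prop :=
  [/\ measurable_fun setT f, forall w, 0 <= f w & (\int[P]_w (f w)%:E <= b%:E)%E].

Lemma nneg_mean_cst c : 0 <= c -> nneg_mean_le (cst c) c.
Proof.
move=> c0; split=> //; change (\int[P]_w cst c%:E w <= c%:E)%E.
by rewrite integral_cst//= probability_setT mule1.
Qed.

Lemma nneg_meanD f g b c : nneg_mean_le f b -> nneg_mean_le g c ->
  nneg_mean_le (fun w => f w + g w) (b + c).
Proof.
move=> [mf f0 fb] [mg g0 gc]; split=> [|w|].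
- exact: measurable_funD.
- by rewrite addr_ge0.
- under eq_integral do rewrite EFinD.
  rewrite ge0_integralD//; last 4 first.
  + by move=> w _; rewrite lee_fin.
  + exact/measurable_EFinP.
  + by move=> w _; rewrite lee_fin.
  + exact/measurable_EFinP.
  by rewrite EFinD leeD.
Qed.

Lemma nneg_mean_sum (I : eqType) (s : seq I) (p : pred I) (f : I -> Omega -> R) b :
  (forall i, i \in s -> p i -> nneg_mean_le (f i) (b i)) ->
  nneg_mean_le (fun w => \sum_(i <- s | p i) f i w) (\sum_(i <- s | p i) b i).
Proof.
elim: s => [|i s ih] H.
  by rewrite big_nil; under eq_fun do rewrite big_nil; exact: nneg_mean_cst.
have {}ih := ih (fun j js => H j (@mem_behead _ (i :: s) j js)).
have [pi|pi] := boolP (p i); last first.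
  by rewrite big_cons (negbTE pi); under eq_fun do rewrite big_cons (negbTE pi).
rewrite big_cons pi; under eq_fun do rewrite big_cons pi.
by apply: nneg_meanD => //; apply: H => //; exact: mem_head.
Qed.

Lemma nneg_mean_indic (A : set Omega) b : measurable A -> (P A <= b%:E)%E ->
  nneg_mean_le \1_A b.
Proof.
move=> mA Ab; split=> [|w|]; first exact: measurable_indic.
- by [].
- by rewrite integral_indic// setIT.
Qed.

End NonnegMean.

Section RegretBound.
Context (R : realType) (M : nat) (K : 'I_M -> nat) (Kpos : forall i, (0 < K i)%N)
  (d : measure_display) (Omega : measurableType d) (P : probability Omega R)
  (F : Arms K -> probability R R) (X : Arms K -> nat -> {RV P >-> R}).
Hypothesis F01 : forall a, F a `[0, 1]%classic = 1%E.
Hypothesis Fsub : forall a, subgaussian1 (F a).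
Hypothesis lawX : forall a t (B : set R), measurable B -> P (X a t @^-1` B) = F a B.
Hypothesis indepX : indep_rounds X.
Local Notation r w := (fun a s => X a s w).
Local Notation mu a := (mean (F a)).

Variables (T : nat) (a0 : Arms K).
Let mstar := mu_star Kpos (fun a => mean (F a)).
Hypothesis a0_opt : mstar = mu a0.
Let L : R := ln T%:R.
Let Delta a := mstar - mu a.

(** The tilt [x] is the optimal Chernoff parameter: as [s%:R * x ^+ 2 = 2 * L], for positive [L] and
    [s] the event says that the average exceeds the mean by at least [x]. *)
Definition over a s :=
  let x := Num.sqrt (2 * L / s%:R) in deviation Kpos X (mu a) x (2 * L) a s T.

Let radius t s : R := Num.sqrt (4 * ln t%:R / s%:R).
(* The reward averages lie in [0, 1]: beyond radius 1 the exponent can be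
   taken as large as needed. *)
Let tilt t s : R := if radius t s <= 1 then radius t s
                    else 3 * ln t%:R / (s%:R * (radius t s - 1)).

(** The negative tilt selects the lower tail. The event depends on [t] through the radius, unlike
    [over], where [ln T] serves all rounds. *)
Definition under t s :=
  deviation Kpos X (mu a0) (- tilt t s) (tilt t s * (s%:R * radius t s)) a0 s t.

Let lnnat_ge0 n : 0 <= ln n%:R :> R.
Proof. by case: n => [|n]; [rewrite ln0|rewrite ln_ge0// ler1n]. Qed.

Let radius_ge0 t s : 0 <= radius t s.
Proof. exact: sqrtr_ge0. Qed.

Lemma tilt_ge0 t s : 0 <= tilt t s.
Proof.
rewrite /tilt; case: (leP (radius t s) 1) => [_|x1]; first exact: radius_ge0.
by rewrite divr_ge0 ?mulr_ge0// subr_ge0 ltW.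
Qed.

Lemma over_le a s : (0 < s)%N -> (0 < T)%N -> (P (over a s) <= (T%:R^-1)%:E)%E.
Proof.
move=> s0 T0; rewrite /over /=; set x := Num.sqrt _.
have sR : 0 < s%:R :> R by rewrite ltr0n.
have L0 : 0 <= L by exact: lnnat_ge0.
apply: (le_trans (deviation_bound Kpos lawX indepX (2 * L) s T (Fsub a x))).
rewrite lee_fin sqr_sqrtr; last by rewrite divr_ge0 ?mulr_ge0.
have -> : s%:R * (2 * L / s%:R / 2) - 2 * L = - L by field; rewrite gt_eqF.
by rewrite expRN lnK// posrE ltr0n.
Qed.

(** The cube leaves [1/t^2] after summing over the fewer than [t] possible counts [s]. For radius
    [x <= 1] the exponent is [- 3/4 * (s%:R * x ^+ 2)], that is [- 3 * ln t]; for larger [x] the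
    tilt is chosen to reach this value. *)
Lemma under_le t s : (0 < s)%N -> (0 < t)%N -> (P (under t s) <= ((t%:R ^+ 3)^-1)%:E)%E.
Proof.
move=> s0 t0; set x := radius t s.
have sR : 0 < s%:R :> R by rewrite ltr0n.
have x0 : 0 <= x by exact: radius_ge0.
have sx2 : s%:R * x ^+ 2 = 4 * ln t%:R.
  rewrite /x /radius sqr_sqrtr; last by rewrite divr_ge0 ?mulr_ge0 ?lnnat_ge0.
  by rewrite mulrC divfK ?gt_eqF.
have rhsE : (t%:R ^+ 3)^-1 = expR (- (3 * ln t%:R)) :> R.
  by rewrite expRN expRM_natl lnK// posrE ltr0n.
rewrite rhsE /under; have := tilt_ge0 t s; rewrite /tilt -/x; case: (leP x 1) => [x1 _|x1 l0].
  apply: (le_trans (deviation_bound Kpos lawX indepX _ s t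
    (lower_mgf_le_variance (F01 a0) _))); first by rewrite x0.
  rewrite lee_fin ler_expR.
  have -> : s%:R * (x ^+ 2 / 4) - x * (s%:R * x) = - (3 / 4) * (s%:R * x ^+ 2) by field.
  by rewrite sx2; lra.
apply: (le_trans (deviation_bound Kpos lawX indepX _ s t
    (lower_mgf_le_mean (F01 a0) l0))).
rewrite lee_fin ler_expR; set l := (3 * _ / _).
have -> : s%:R * (l * mu a0) - l * (s%:R * x) = - (l * (s%:R * (x - mu a0))) by ring.
rewrite lerN2; have -> : 3 * ln t%:R = l * (s%:R * (x - 1)).
  by rewrite /l divfK// mulf_neq0 ?gt_eqF// subr_gt0.
apply: ler_wpM2l => //; apply: ler_wpM2l; first exact: ltW.
by rewrite lerD2l lerN2; exact: mean_le1.
Qed.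

Lemma regret_step w t : (Nprod K <= t < T)%N ->
  let a := play Kpos (r w) t.+1 in let j := n_played (history Kpos (r w) t) a in
  0 < Delta a ->
  [\/ j%:R < (6 + 4 * Num.sqrt 2) * L / Delta a ^+ 2, j = 0%N,
      (0 < j)%N /\ (1 : R) <= \1_(over a j) w |
      exists2 s, (1 <= s < t.+1)%N & (1 : R) <= \1_(under t.+1 s) w].
Proof.
move=> /andP[Nt tT] a j Da; have [j0|j0] := posnP j; first by constructor 2.
have [ju|uj] := ltP j%:R ((6 + 4 * Num.sqrt 2) * L / Delta a ^+ 2); first by constructor 1.
have [s0 ucb] := play_ucb a0 Nt j0.
set s := n_played (history Kpos (r w) t) a0 in s0 ucb.
(* The index at round [t.+1 <= T] uses [ln t.+1], at most [L]. *)
have lL : 0 <= (ln t.+1%:R : R) <= L.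
  apply/andP; split; first exact: lnnat_ge0.
  by rewrite ler_ln ?posrE ?ltr0n ?ler_nat// (leq_ltn_trans _ tT).
have mua : mu a < mu a0 by rewrite -a0_opt -subr_gt0.
have jR : 0 < j%:R :> R by rewrite ltr0n.
have sR : 0 < s%:R :> R by rewrite ltr0n.
move: uj; rewrite /Delta a0_opt => uj.
case: (over_or_under lL jR sR mua uj ucb) => [ov|un].
  constructor 3; split => //; rewrite indicE mem_set//.
  by exists t; rewrite // ltnW.
constructor 4; exists s.
  by rewrite s0 ltnS (leq_trans (n_played_size _ _))// size_history.
rewrite indicE mem_set//; exists t; first exact: leqW.
split => //; rewrite mulNr -mulrN ler_wpM2l ?tilt_ge0//.
by move: un; rewrite /radius; lra.
Qed.

Lemma mean_regret_le :
  (\int[P]_w (\sum_(t < T) Delta (play Kpos (r w) t.+1))%:E <=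
   ((3 * Nprod K)%:R
    + (1 + \sum_(a : Arms K | Num.sqrt (L / T%:R) < Delta a) (6 + 4 * Num.sqrt 2))
      * Num.sqrt (T%:R * L))%:E)%E.
Proof.
set eps := Num.sqrt (L / T%:R); set c := 6 + 4 * Num.sqrt 2; set N := Nprod K.
set q := Num.sqrt (T%:R * L).
have L0 : 0 <= L by exact: lnnat_ge0.
have q0 : 0 <= q by exact: sqrtr_ge0.
have eps0 : 0 <= eps by exact: sqrtr_ge0.
have c0 : 0 <= c by rewrite addr_ge0// mulr_ge0// sqrtr_ge0.
have Delta0 a : 0 <= Delta a by rewrite subr_ge0; exact: le_mu_star.
have Delta1 a : Delta a <= 1.
  rewrite /Delta a0_opt; have := mean_le1 (F01 a0); have := mean_ge0 (F01 a); lra.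
have Teps : T%:R * eps = q.
  (* For [T = 0] both sides vanish. *)
  have [T0|T0] := posnP T; first by rewrite /q T0 mulr0n !mul0r sqrtr0.
  have TR : 0 < T%:R :> R by rewrite ltr0n.
  rewrite /eps -[X in X * _]ger0_norm// -sqrtr_sqr -sqrtrM ?sqr_ge0//; congr Num.sqrt.
  by field; rewrite gt_eqF.
have epsq : eps * q = L.
  rewrite -Teps; have [T0|T0] := posnP T.
    by rewrite /L T0 ln0// mul0r mulr0.
  by rewrite mulrCA -expr2 sqr_sqrtr ?divr_ge0// mulrC divfK// pnatr_eq0 -lt0n.
pose u a := c * L / Delta a ^+ 2.
(* A gap above [eps] makes [L / Delta a] at most [L / eps], which is [q]. *)
have Du a : eps < Delta a -> Delta a * u a <= c * q.
  move=> Da; have D0 := le_lt_trans eps0 Da.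
  have -> : Delta a * u a = c * (L / Delta a) by rewrite /u; field; rewrite gt_eqF.
  by rewrite ler_wpM2l// ler_pdivrMr// -epsq mulrC ler_wpM2l// ltW.
pose f w := N%:R + T%:R * eps
    + \sum_(a | eps < Delta a) (Delta a * (u a + 1) + \sum_(1 <= j < T) \1_(over a j) w)
    + \sum_(N <= t < T) \sum_(1 <= s < t.+1) \1_(under t.+1 s) w : R.
pose b := N%:R + T%:R * eps
    + \sum_(a | eps < Delta a) (Delta a * (u a + 1) + \sum_(1 <= j < T) T%:R^-1)
    + \sum_(N <= t < T) \sum_(1 <= s < t.+1) (t.+1%:R ^+ 3)^-1 : R.
have u0 a : 0 <= u a by rewrite divr_ge0 ?mulr_ge0// sqr_ge0.
have fb : nneg_mean_le P f b.
  apply: nneg_meanD; first apply: nneg_meanD.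
  - by apply: nneg_mean_cst; rewrite addr_ge0 ?mulr_ge0.
  - apply: nneg_mean_sum => a _ Da; apply: nneg_meanD.
      by apply: nneg_mean_cst; rewrite mulr_ge0// addr_ge0.
    apply: nneg_mean_sum => j; rewrite mem_index_iota => /andP[j0 jT] _.
    apply: nneg_mean_indic; first exact: measurable_deviation.
    by apply: over_le => //; exact: leq_trans jT.
  - apply: nneg_mean_sum => t _ _; apply: nneg_mean_sum => s.
    rewrite mem_index_iota => /andP[s0 _] _.
    apply: nneg_mean_indic; first exact: measurable_deviation.
    exact: under_le.
have pointwise w : \sum_(t < T) Delta (play Kpos (r w) t.+1) <= f w.
  apply: regret_pointwise => // t tNT a j Da.
  by apply: regret_step => //; exact: le_lt_trans Da.
have bbound : b <= (3 * N)%:R + (1 + \sum_(a : Arms K | eps < Delta a) c) * q.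
  pose nb := #|[pred a | eps < Delta a]|.
  (* The optimal tuple has gap 0 and is not counted; its unit pays for [under_sum]. *)
  have nbN : nb.+1%:R <= N%:R :> R.
    have : (nb <= #|predC1 a0|)%N.
      apply: subset_leq_card; apply/fintype.subsetP => a; rewrite !inE.
      by apply: contraTneq => ->; rewrite /Delta a0_opt subrr -leNgt.
    by rewrite cardC1 -Nprod_card -ltnS prednK ?Nprod_gt0// ler_nat.
  have under_sum : \sum_(N <= t < T) \sum_(1 <= s < t.+1) (t.+1%:R ^+ 3)^-1 <= 1 :> R.
    apply: le_trans (sum_inv_sqr R T (Nprod_gt0 Kpos)).
    apply: ler_sum => t _; rewrite sumr_const_nat subn1 /= -[leLHS]mulr_natl.
    have t0 : 0 < t.+1%:R :> R by rewrite ltr0n.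
    by rewrite exprS invfM mulrA ler_piMl ?invr_ge0 ?sqr_ge0// ler_pdivrMr// mul1r ler_nat.
  have over_sum : \sum_(1 <= j < T) T%:R^-1 <= 1 :> R.
    rewrite sumr_const_nat; have [T0|T0] := posnP T; first by rewrite T0.
    by rewrite -[leLHS]mulr_natl ler_pdivrMr ?ltr0n// mul1r ler_nat leq_subr.
  have big_sum : \sum_(a | eps < Delta a) (Delta a * (u a + 1) + \sum_(1 <= j < T) T%:R^-1)
      <= (\sum_(a : Arms K | eps < Delta a) c) * q + nb%:R * 2.
    have -> : nb%:R * 2 = \sum_(a : Arms K | eps < Delta a) 2 :> R.
      by rewrite sumr_const mulr_natl.
    rewrite mulr_suml -big_split /=; apply: ler_sum => a Da.
    by have := Du a Da; have := Delta1 a; rewrite mulrDr mulr1; lra.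
  rewrite /b Teps natrM mulrDl mul1r.
  (* The constants amount to [N + 2 * nb + 1], below [3 * N]. *)
  by move: nbN; rewrite -natr1; lra.
apply: (@le_trans _ _ b%:E); last by rewrite lee_fin.
case: fb => mf f0 fb; apply: le_trans fb.
apply: ge0_le_integral => //.
- by move=> w _; rewrite lee_fin sumr_ge0.
- apply/measurable_EFinP; apply: measurable_sum => t.
  have mX b' s : (s <= T)%N -> measurable_fun setT (X b' s).
    by move=> _; exact: measurable_funP.
  apply: (@measurable_fun_history _ _ _ Kpos _ _ _ T mX _ _ t.+1
    (fun h _ => Delta (nth (init_tuple Kpos 1) h t))) => //.
  exact: leqW.
- exact/measurable_EFinP.
- by move=> w _; rewrite lee_fin pointwise.
Qed.

End RegretBound.

(** * Expected rewards *)

Section MeanReward.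
Context (R : realType) (M : nat) (K : 'I_M -> nat) (Kpos : forall i, (0 < K i)%N)
  (d : measure_display) (Omega : measurableType d) (P : probability Omega R)
  (F : Arms K -> probability R R) (X : Arms K -> nat -> {RV P >-> R}).
Hypothesis F01 : forall a, F a `[0, 1]%classic = 1%E.
Hypothesis lawX : forall a t (B : set R), measurable B -> P (X a t @^-1` B) = F a B.
Hypothesis indepX : indep_rounds X.
Local Notation r w := (fun a s => X a s w).
Local Notation pl w t := (play Kpos (r w) t.+1).

Lemma measurable_fun_play d' (E : measurableType d') (phi : Arms K -> Omega -> E) t :
  (forall a, measurable_fun setT (phi a)) ->
  measurable_fun setT (fun w => phi (pl w t) w).
Proof.
move=> mphi.
have mX b s : (s <= t)%N -> measurable_fun setT (X b s).
  by move=> _; exact: measurable_funP.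
exact: (@measurable_fun_history _ _ _ Kpos _ _ _ t mX _ _ t.+1
  (fun h w => phi (nth (init_tuple Kpos 1) h t) w)).
Qed.

(** Splitting by the tuple played at round [t.+1], each selector is a function of the past, hence
    independent of the fresh reward. *)
Lemma integral_play_reward t :
  (\int[P]_w (clamp (X (pl w t) t.+1 w))%:E = \int[P]_w (mean (F (pl w t)))%:E)%E.
Proof.
have mpast b s : (s <= t)%N ->
    measurable_fun setT (X b s : g_sigma_algebraType (past X t) -> R).
  exact: measurable_past.
pose sel a w : R := if pl w t == a then 1 else 0.
have sel0 a w : 0 <= sel a w by rewrite /sel; case: ifP.
have msel a : measurable_fun setT (sel a : g_sigma_algebraType (past X t) -> R).
  apply: measurable_fun_ifT => //; exact: (measurable_play Kpos mpast).
have mclamp a : measurable_fun setT (fun w => clamp (X a t.+1 w)).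
  by apply: measurableT_comp; [exact: measurable_clamp|exact: measurable_funP].
have split (g : Arms K -> Omega -> R) w :
    (g (pl w t) w)%:E = (\sum_(a : Arms K) (sel a w * g a w)%:E)%E.
  rewrite (bigD1 (pl w t))//= /sel eqxx mul1r big1 ?adde0// => a ne.
  by rewrite eq_sym (negbTE ne) mul0r.
have msel' a : measurable_fun setT (sel a) by exact: measurable_from_past (msel a).
under eq_integral => w _ do rewrite (split (fun a w => clamp (X a t.+1 w))).
under [RHS]eq_integral => w _ do rewrite (split (fun a _ => mean (F a))).
have mselX a : measurable_fun setT (fun w => (sel a w * clamp (X a t.+1 w))%:E).
  by apply/measurable_EFinP; exact: measurable_funM.
have mselF a : measurable_fun setT (fun w => (sel a w * mean (F a))%:E).
  by apply/measurable_EFinP; exact: measurable_funM.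
have selX0 a w : setT w -> (0 <= (sel a w * clamp (X a t.+1 w))%:E)%E.
  by move=> _; rewrite lee_fin mulr_ge0// clamp_ge0.
have selF0 a w : setT w -> (0 <= (sel a w * mean (F a))%:E)%E.
  by move=> _; rewrite lee_fin mulr_ge0//; exact: mean_ge0.
rewrite (ge0_integral_sum P measurableT mselX selX0).
rewrite (ge0_integral_sum P measurableT mselF selF0).
apply: eq_bigr => a _.
under eq_integral do rewrite EFinM.
under [RHS]eq_integral do rewrite EFinM.
have esel : measurable_fun setT (fun w => (sel a w)%:E) by exact/measurable_EFinP.
have eselp : measurable_fun setT (EFin \o sel a : g_sigma_algebraType (past X t) -> \bar R).
  exact/measurable_EFinP.
have eclamp : measurable_fun setT (EFin \o @clamp R).
  by apply/measurable_EFinP; exact: measurable_clamp.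
have esel0 w : (0 <= (EFin \o sel a) w)%E by rewrite lee_fin.
have eclamp0 x : (0 <= (EFin \o @clamp R) x)%E by rewrite lee_fin clamp_ge0.
rewrite (ge0_integralM_past indepX a eselp eclamp esel0 eclamp0).
rewrite (integral_law lawX a t.+1 eclamp eclamp0) -mean_clamp//.
have m0 : (0 <= (mean (F a))%:E)%E by rewrite lee_fin mean_ge0.
by rewrite ge0_integralZr// => w _; exact: esel0.
Qed.

(** Clamped rewards agree almost surely with the rewards and are bounded, so linearity applies; each
    round is then replaced by its mean. *)
Lemma expectation_regret T :
  ('E_P[fun w => (T%:R * mu_star Kpos (fun a => mean (F a)) - total_reward Kpos (r w) T)%R]
   = \int[P]_w (\sum_(t < T)
       (mu_star Kpos (fun a => mean (F a)) - mean (F (pl w t))))%:E)%E.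
Proof.
set ms := mu_star _ _.
pose C w := \sum_(t < T) clamp (X (pl w t) t.+1 w).
pose H w := \sum_(t < T) mean (F (pl w t)).
have mC : measurable_fun setT C.
  apply: measurable_sum => t.
  apply: (measurable_fun_play (phi := fun a w => clamp (X a t.+1 w))) => a.
  by apply: measurableT_comp; [exact: measurable_clamp|exact: measurable_funP].
have mH : measurable_fun setT H.
  apply: measurable_sum => t.
  exact: (measurable_fun_play (phi := fun a _ => mean (F a))).
have bounded_int (g : Omega -> R) : measurable_fun setT g ->
    (forall w, 0 <= g w <= T%:R) -> P.-integrable setT (fun w => (g w)%:E).
  move=> mg gT; apply: (measurable_bounded_integrable _ _ mg) => //.
    by rewrite ltey_eq fin_num_measure.
  exists T%:R; split => // b Tb w _ /=; case/andP: (gT w) => g0 g1.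
  by rewrite ger0_norm// (le_trans g1)// ltW.
have sum_bound (g : 'I_T -> R) : (forall t, 0 <= g t <= 1) -> 0 <= \sum_t g t <= T%:R.
  move=> g01; apply/andP; split; first by apply: sumr_ge0 => t _; case/andP: (g01 t).
  apply: (@le_trans _ _ (\sum_(t < T) 1)); last by rewrite sumr_const card_ord.
  by apply: ler_sum => t _; case/andP: (g01 t).
have iC : P.-integrable setT (fun w => (C w)%:E).
  by apply: bounded_int => // w; apply: sum_bound => t; rewrite clamp_ge0 clamp_le1.
have iH : P.-integrable setT (fun w => (H w)%:E).
  by apply: bounded_int => // w; apply: sum_bound => t; rewrite mean_ge0 ?mean_le1.
have CH : (\int[P]_w (C w)%:E = \int[P]_w (H w)%:E)%E.
  under eq_integral do rewrite -sumEFin.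
  under [RHS]eq_integral do rewrite -sumEFin.
  have mCt (t : 'I_T) : measurable_fun setT (fun w => (clamp (X (pl w t) t.+1 w))%:E).
    apply/measurable_EFinP.
    apply: (measurable_fun_play (phi := fun a w => clamp (X a t.+1 w))) => a.
    by apply: measurableT_comp; [exact: measurable_clamp|exact: measurable_funP].
  have mHt (t : 'I_T) : measurable_fun setT (fun w => (mean (F (pl w t)))%:E).
    apply/measurable_EFinP.
    exact: (measurable_fun_play (phi := fun a _ => mean (F a))).
  have Ct0 (t : 'I_T) w : setT w -> (0 <= (clamp (X (pl w t) t.+1 w))%:E)%E.
    by move=> _; rewrite lee_fin clamp_ge0.
  have Ht0 (t : 'I_T) w : setT w -> (0 <= (mean (F (pl w t)))%:E)%E.
    by move=> _; rewrite lee_fin mean_ge0.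
  rewrite (ge0_integral_sum P measurableT mCt Ct0).
  rewrite (ge0_integral_sum P measurableT mHt Ht0).
  by apply: eq_bigr => t _; exact: integral_play_reward.
have icst : P.-integrable setT (fun _ => (T%:R * ms)%:E).
  exact: (finite_measure_integrable_cst P (T%:R * ms) measurableT).
have mcst : measurable_fun setT (cst (T%:R * ms) : Omega -> R) by exact: measurable_cst.
transitivity (\int[P]_w ((T%:R * ms)%:E - (C w)%:E))%E.
  rewrite unlock; apply: ae_eq_integral => //.
  - apply/measurable_EFinP; apply: measurable_funB => //.
    under eq_fun do rewrite total_rewardE.
    apply: measurable_sum => t.
    apply: (measurable_fun_play (phi := fun a w => X a t.+1 w)) => a.
    exact: measurable_funP.
  - by apply: emeasurable_funB; exact/measurable_EFinP.
  (* The played tuple is random, so the bound is needed for all finitely many pairs of round and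
     tuple at once. *)
  - have : \forall w \near almost_everywhere P,
        forall i : 'I_T * Arms K, 0 <= X i.2 i.1.+1 w <= 1.
      apply: filter_forall => -[t a] /=.
      exists (X a t.+1 @^-1` ~` `[0, 1]%classic); split.
      + by rewrite -[X in measurable X]setTI; apply: measurable_funP => //; exact: measurableC.
      + by rewrite lawX; [rewrite probability_setC// F01 subee|exact: measurableC].
      + by move=> w /=; rewrite in_itv.
    apply: filterS => w Hw _; rewrite total_rewardE -EFinB; congr (_ - _)%:E.
    by apply: eq_bigr => t _; rewrite clamp_id//; exact: (Hw (t, pl w t)).
rewrite integralB_EFin//.
rewrite CH -integralB_EFin//.
apply: eq_integral => w _; rewrite -EFinB sumrB sumr_const card_ord.
by rewrite mulr_natl.
Qed.

End MeanReward.

Theorem theorem2 (R : realType) (M : nat) (K : 'I_M -> nat)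
    (Kpos : forall i, (0 < K i)%N)
    (d : measure_display) (Omega : measurableType d) (P : probability Omega R)
    (F : Arms K -> probability R R)
    (X : Arms K -> nat -> {RV P >-> R}) :
  (forall a, F a `[0%R, 1%R]%classic = 1%E) ->
  (forall a, subgaussian1 (F a)) ->
  (forall a t (B : set R), measurable B -> P (X a t @^-1` B) = F a B) ->
  indep_rounds X ->
  forall T : nat,
    let mu := fun a => mean (F a) in
    let Delta := fun a => mu_star Kpos mu - mu a in
    let eps : R := Num.sqrt (ln T%:R / T%:R) in
    ('E_P[fun w => (T%:R * mu_star Kpos mu
                   - total_reward Kpos (fun a s => X a s w) T)%R]
     <= ((3 * Nprod K)%:R
         + (1 + \sum_(a : Arms K | Delta a > eps) (6 + 4 * Num.sqrt 2))
           * Num.sqrt (T%:R * ln T%:R))%:E)%E.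
Proof.
move=> F01 Fsub lawX indepX T; lazy zeta.
have [a0 a0_opt] := mu_star_attained Kpos (fun a => mean (F a)).
rewrite expectation_regret//.
exact: (mean_regret_le F01 Fsub lawX indepX T a0_opt).
Qed.
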